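(* For $f\in C(\mathbb{R};\mathbb{R})$ satisfying $xf(x)>0$ for all $x\ne0$ and $f(0)=0$, and for $y\ge0$, let $\underline{x}(f,y)\ge0$ denote the unique solution $\underline{x}$ of $$2\underline{x}+\max_{|x|\le\underline{x}}|f(x)|=y .$$ Then: (i) For each such $f$, the function $y\mapsto\underline{x}(f,y)$ is increasing, $\lim_{y\to\infty}\underline{x}(f,y)=+\infty$ and $\lim_{y\to0^+}\underline{x}(f,y)=0$. (ii) If $f_1,f_2\in C(\mathbb{R};\mathbb{R})$ both satisfy $xf_i(x)>0$ for all $x\neq0$ and $f_i(0)=0$, and $|f_2(x)|\ge|f_1(x)|$ for all $x\in\mathbb{R}$, then $\underline{x}(f_1,y)\ge\underline{x}(f_2,y)$ for all $y\ge0$. *)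

(* Defs.v *)
From HB Require Import structures.
From mathcomp Require Import all_boot all_order all_algebra.
From mathcomp Require Import all_classical all_reals all_analysis.
Set Implicit Arguments.
Unset Strict Implicit.
Unset Printing Implicit Defensive.
Import Order.TTheory GRing.Theory Num.Theory.
Import numFieldNormedType.Exports.
Local Open Scope classical_set_scope.
Local Open Scope ring_scope.

Definition is_max (R : realType) (A : set R) (m : R) : Prop :=
  A m /\ ubound A m.

Definition sign_restoring (R : realType) (f : R -> R) : Prop :=
  [/\ continuous f, forall x, x != 0 -> 0 < x * f x & f 0 = 0].

Definition max_abs_on (R : realType) (f : R -> R) (r m : R) : Prop :=
  is_max [set `|f x| | x in [set x | `|x| <= r]] m.

(* The maximum is a relation rather than a function, so that a solution carries
   the fact that the maximum is attained. *)
Definition is_underx (R : realType) (f : R -> R) (y x : R) : Prop :=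
  0 <= x /\ exists m, max_abs_on f x m /\ 2 * x + m = y.

(* The value 0 is only a default for the case when there is no solution. *)
Definition underx (R : realType) (f : R -> R) (y : R) : R :=
  xget 0 [set x | is_underx f y x].

(* Main.v *)
(* The map [x |-> 2 x + max_{|z| <= x} |f z|] is strictly increasing in [x] and
   monotone in [|f|], so everything but existence follows by comparing the
   defining equations: divergence because every [x >= 0] is the solution for
   some [y], and the limit at [0] because [2 x <= y]. *)
Require Import Defs.
From HB Require Import structures.
From mathcomp Require Import all_boot all_order all_algebra.
From mathcomp Require Import all_classical all_reals all_analysis.
From mathcomp Require Import lra.
Set Implicit Arguments.
Unset Strict Implicit.
Unset Printing Implicit Defensive.
Import Order.TTheory GRing.Theory Num.Theory.
Import numFieldNormedType.Exports.
Local Open Scope classical_set_scope.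
Local Open Scope ring_scope.

Section underx_theory.
Variable R : realType.
Implicit Types (f : R -> R) (r m x y : R).

Lemma max_abs_on_exists f r : continuous f -> 0 <= r ->
  exists m, max_abs_on f r m.
Proof.
move=> cf r0; have rr : - r <= r by lra.
have cnf : {within `[- r, r], continuous (fun x => `|f x|)}.
  apply: continuous_subspaceT => x.
  by apply: (@continuous_comp _ _ _ f Num.norm); [exact: cf|exact: norm_continuous].
have [c crr fc] := EVT_max rr cnf.
exists `|f c|; split; first by exists c => //=; move: crr; rewrite in_itv /= -ler_norml.
by move=> _ [x xr <-]; apply: fc; rewrite in_itv /= -ler_norml.
Qed.

(** The point where [|f1|] attains [m1] also lies within radius [r2]. Function and radius vary
    together so that one comparison serves both monotonicity in [y] and part (ii). *)
Lemma max_abs_on_mono f1 f2 r1 r2 m1 m2 :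
  (forall x, `|f1 x| <= `|f2 x|) -> r1 <= r2 ->
  max_abs_on f1 r1 m1 -> max_abs_on f2 r2 m2 -> m1 <= m2.
Proof.
move=> f12 r12 [[z zr1 <-] _] [_ ub2]; apply: le_trans (f12 z) _.
by apply: ub2; exists z => //=; exact: le_trans zr1 r12.
Qed.

(** The term [2 * x] grows strictly while the maximum does not decrease. Taking [f1 = f2] gives
    uniqueness and monotonicity in [y]; taking [y1 = y2] gives antitonicity in [|f|]. *)
Lemma is_underx_lt f1 f2 x1 x2 y1 y2 : (forall x, `|f1 x| <= `|f2 x|) ->
  x1 < x2 -> is_underx f1 y1 x1 -> is_underx f2 y2 x2 -> y1 < y2.
Proof.
move=> f12 x12 [_ [m1 [M1 <-]]] [_ [m2 [M2 <-]]].
have m12 := max_abs_on_mono f12 (ltW x12) M1 M2.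
by lra.
Qed.

Lemma is_underx_inj f x1 x2 y : is_underx f y x1 -> is_underx f y x2 -> x1 = x2.
Proof.
move=> U1 U2; have ff x : `|f x| <= `|f x| by [].
have [x12|x21|//] := ltgtP x1 x2.
  by have := is_underx_lt ff x12 U1 U2; rewrite ltxx.
by have := is_underx_lt ff x21 U2 U1; rewrite ltxx.
Qed.

Lemma is_underx_fun f x y1 y2 : is_underx f y1 x -> is_underx f y2 x -> y1 = y2.
Proof.
move=> [_ [m1 [M1 <-]]] [_ [m2 [M2 <-]]].
have mono n1 n2 := @max_abs_on_mono f f x x n1 n2 (fun=> lexx _) (lexx x).
have m12 := mono _ _ M1 M2; have m21 := mono _ _ M2 M1.
by lra.
Qed.

(* The solution is the largest [x] such that [2 x + |f z| <= y] whenever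
   [|z| <= x]. *)
Lemma is_underx_exists f y : continuous f -> f 0 = 0 -> 0 <= y ->
  exists x, is_underx f y x.
Proof.
move=> cf f0 y0.
have cnf x : {for x, continuous (fun x => `|f x|)}.
  by apply: (@continuous_comp _ _ _ f Num.norm); [exact: cf|exact: norm_continuous].
pose S := [set x | 0 <= x /\ forall z, `|z| <= x -> 2 * x + `|f z| <= y].
have S0 : S 0.
  split=> // z; rewrite normr_le0 => /eqP ->.
  by rewrite f0 normr0; lra.
have Sub : has_ubound S.
  exists (y / 2) => x [x0 /(_ 0)]; rewrite normr0 f0 normr0 => /(_ x0).
  by lra.
have hS : has_sup S by split => //; exists 0.
set s := sup S; have s0 : 0 <= s by exact: ub_le_sup.
have [m sm] := max_abs_on_exists cf s0.
exists s; split => //; exists m; split => //.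
have [[z0 /= z0s fz0] mub] := sm.
apply/eqP; rewrite eq_le; apply/andP; split; rewrite leNgt; apply/negP => lt.
- (* Points [x] of [S] near [s] are tested at [t * x], which is near [z0]. *)
  pose t := z0 / s.
  have ts : t * s = z0.
    (* If [s = 0], then [|z0| <= s] forces [z0 = 0], so the identity survives the division by
       zero. *)
    have [s_eq0|sn0] := eqVneq s 0; last by rewrite /t divfK.
    by move: z0s; rewrite s_eq0 normr_le0 mulr0 => /eqP ->.
  have t1 : `|t| <= 1.
    rewrite /t normrM normfV (ger0_norm s0).
    have [->|sn0] := eqVneq s 0; first by rewrite invr0 mulr0.
    by rewrite ler_pdivrMr ?mul1r// lt_def sn0.
  have cg : (fun x => 2 * x + `|f (t * x)|) x @[x --> s] --> 2 * s + m.
    rewrite -fz0 -ts; apply: cvgD; first by apply: cvgMr; exact: cvg_id.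
    apply: (@continuous_comp _ _ _ (fun x => t * x) (fun x => `|f x|)) => //.
    by apply: cvgMr; exact: cvg_id.
  have /nbhs_ballP[d /= d0 sd] : \forall x \near s, y < 2 * x + `|f (t * x)|.
    exact: cvgr_gt cg _ lt.
  have [x [x0 Sx] xs] := sup_adherent d0 hS.
  have xles : x <= s by apply: ub_le_sup.
  have /= : y < 2 * x + `|f (t * x)|.
    by apply: sd; rewrite /ball /= ltr_norml; move: xs; rewrite -/s; lra.
  have : 2 * x + `|f (t * x)| <= y.
    by apply: Sx; rewrite normrM (ger0_norm x0) ler_piMl.
  by lra.
(* Here [y = 2 * s + m + 2 * e]: one [e] pays for enlarging [s] to [s + d] with [2 * d <= e], the
   other for the growth of [|f|]. Then [s + d] lies in [S], against the choice of [s]. *)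
- pose e := (y - (2 * s + m)) / 2; have e0 : 0 < e by rewrite /e; lra.
  have fle z : `|z| <= s -> `|f z| <= m by move=> zs; apply: mub; exists z.
  have nearS z : `|z| <= s -> \forall x \near z, `|f x| < m + e.
    by move=> zs; apply: cvgr_lt (cnf z) _ _; have := fle z zs; lra.
  (* The endpoints [s] and [- s] suffice: a point with [s < |z| <= s + d] is within [d] of one of
     them. *)
  have /nearS/nbhs_ballP[d1 /= d10 H1] : `|s| <= s by rewrite ger0_norm.
  have /nearS/nbhs_ballP[d2 /= d20 H2] : `|- s| <= s by rewrite normrN ger0_norm.
  pose d := Num.min (e / 2) (Num.min (d1 / 2) (d2 / 2)).
  have d0 : 0 < d by rewrite !lt_min; lra.
  have [de dd1 dd2] : [/\ d <= e / 2, d < d1 & d < d2].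
    split; first by rewrite ge_min lexx.
      by rewrite !gt_min; apply/orP; right; apply/orP; left; lra.
    by rewrite !gt_min; apply/orP; right; apply/orP; right; lra.
  suff : s + d <= s by lra.
  apply: ub_le_sup => //; split; first by lra.
  move=> z zsd; suff : `|f z| <= m + e by rewrite /e in de *; lra.
  have [/fle|zs] := leP `|z| s; first by lra.
  apply: ltW; have [z_ge0|z_lt0] := lerP 0 z.
    by apply: H1; rewrite /ball /= ltr_norml; rewrite ger0_norm // in zsd zs; lra.
  by apply: H2; rewrite /ball /= ltr_norml; rewrite ltr0_norm // in zsd zs; lra.
Qed.

Lemma underxP f y : sign_restoring f -> 0 <= y -> is_underx f y (underx f y).
Proof.
move=> [cf _ f0] y0; have := is_underx_exists cf f0 y0.
exact: xgetPex.
Qed.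

(** No existence is required, since the default value [0] is itself nonnegative. *)
Lemma underx_ge0 f y : 0 <= underx f y.
Proof. by rewrite /underx; case: xgetP => // x _ []. Qed.

Lemma underx_le_half f y : sign_restoring f -> 0 <= y -> underx f y <= y / 2.
Proof.
move=> sf y0; have [_ [m [[[z _ <-] _] /eqP]]] := underxP sf y0.
by have := normr_ge0 (f z); rewrite eq_le => + /andP[]; lra.
Qed.

Lemma underx_antitone f1 f2 y : sign_restoring f1 -> sign_restoring f2 ->
  (forall x, `|f1 x| <= `|f2 x|) -> 0 <= y -> underx f2 y <= underx f1 y.
Proof.
move=> sf1 sf2 f12 y0; rewrite leNgt; apply/negP => x12.
by have := is_underx_lt f12 x12 (underxP sf1 y0) (underxP sf2 y0); rewrite ltxx.
Qed.

Lemma underx_increasing f y1 y2 : sign_restoring f ->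
  0 <= y1 -> y1 < y2 -> underx f y1 < underx f y2.
Proof.
move=> sf y10 y12; have y20 := ltW (le_lt_trans y10 y12).
have [U1 U2] := (underxP sf y10, underxP sf y20).
(* Equal solutions would force [y1 = y2], and a smaller second solution would force [y2 < y1]. *)
rewrite ltNge le_eqVlt; apply/negP => /orP[/eqP x21|x21].
  by rewrite x21 in U2; move: y12; rewrite (is_underx_fun U1 U2) ltxx.
by have := is_underx_lt (fun x => lexx `|f x|) x21 U2 U1; lra.
Qed.

Lemma underx_cvgy f : sign_restoring f -> underx f y @[y --> +oo] --> +oo.
Proof.
move=> sf; have [cf _ _] := sf; apply/cvgryPge => A.
have A0 : 0 <= Num.max 0 A by rewrite le_max lexx.
have [m Mm] := max_abs_on_exists cf A0.
(* [y0] is chosen so that its solution is [max 0 A], a legitimate radius even for negative [A];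
   monotonicity then covers all [y > y0]. *)
pose y0 := 2 * Num.max 0 A + m.
have y00 : 0 <= y0 by have [[z _ zm] _] := Mm; rewrite addr_ge0 ?mulr_ge0 // -zm.
have U0 : is_underx f y0 (Num.max 0 A) by split => //; exists m.
near=> y; apply: (@le_trans _ _ (Num.max 0 A)); first by rewrite le_max lexx orbT.
rewrite (is_underx_inj U0 (underxP sf y00)); apply/ltW/underx_increasing => //.
by near: y; apply: nbhs_pinfty_gt; exact: num_real.
Unshelve. all: by end_near. Qed.

Lemma underx_cvg0 f : sign_restoring f -> underx f y @[y --> 0^'+] --> (0 : R).
Proof.
move=> sf; apply: (@squeeze_cvgr _ _ _ _ (cst 0) (fun y => y / 2)).
- near=> y; rewrite underx_ge0 underx_le_half //.
- exact: cvg_cst.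
- apply: cvg_at_right_filter; rewrite -[X in _ --> X](mul0r 2^-1).
  by apply: cvgMl; exact: cvg_id.
Unshelve. all: by end_near. Qed.

End underx_theory.

(** The first conjunct ensures that for [0 <= y] the value [underx f y] is the unique solution and
    never the default. *)
Theorem proposition6 (R : realType) :
  (forall f : R -> R, sign_restoring f ->
     forall y : R, 0 <= y -> exists! x : R, is_underx f y x) /\
  (forall f : R -> R, sign_restoring f ->
     [/\ forall y1 y2 : R, 0 <= y1 -> y1 < y2 -> underx f y1 < underx f y2,
         underx f y @[y --> +oo] --> +oo
       & underx f y @[y --> 0^'+] --> (0 : R)]) /\
  (forall f1 f2 : R -> R, sign_restoring f1 -> sign_restoring f2 ->
     (forall x : R, `|f1 x| <= `|f2 x|) ->
     forall y : R, 0 <= y -> underx f2 y <= underx f1 y).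
Proof.
split=> [f [cf _ f0] y y0|].
  have [x xP] := is_underx_exists cf f0 y0.
  by exists x; split=> // x'; exact: is_underx_inj.
split=> [f sf|f1 f2 sf1 sf2 f12 y]; last exact: underx_antitone.
split; [|exact: underx_cvgy|exact: underx_cvg0].
by move=> y1 y2; exact: underx_increasing.
Qed.
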